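(* Let $\mathcal{R}$ be the Rubik's cube group and $G_\mathcal{R}$ its Cayley graph with respect to the half-turn generating set (see context). For a state $s \in \mathcal{R}$ let $d(s)$ denote the distance in $G_\mathcal{R}$ from $s$ to the solved state (the identity), and let $D$ be the diameter of $G_\mathcal{R}$. Let $S$ be a collection of states of the Rubik's cube sampled independently and uniformly at random from $\mathcal{R}$, and let $\widehat{\mu}_S = \frac{1}{|S|}\sum_{s \in S} d(s)$. Then \[ \Pr_S\left[ D \geq 2\widehat{\mu}_S + 0.36 \right] < 2\exp\left(\frac{-|S|}{1\,541\,939}\right). \]
   Context: Label the $54$ stickers (facelets) of the $3\times3\times3$ Rubik's cube. Each of the six faces (Up $U$, Down $D$, Left $L$, Right $R$, Front $F$, Back $B$) gives a permutation of the $54$ stickers, namely the clockwise quarter turn of that face. The Rubik's cube group $\mathcal{R}$ is the subgroup of the symmetric group $S_{54}$ generated by these six permutations; its elements are the states of the cube, the identity being the solved state. The half-turn generating set is $S_\mathcal{R} = \{X, X^2, X^3 : X \in \{U,D,L,R,F,B\}\}$ (18 elements; a quarter turn, half turn or inverse quarter turn of any face counts as one move). The Cayley graph $G_\mathcal{R}$ has vertex set $\mathcal{R}$, with $g$ and $h$ adjacent iff $h = g\circ s$ for some $s \in S_\mathcal{R}$. Distance is the shortest-path distance in this graph and the diameter is the maximum distance between two vertices. *)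

(* Defs.v *)
From HB Require Import structures.
From mathcomp Require Import all_boot all_order all_algebra all_fingroup.
From mathcomp Require Import all_classical all_reals all_analysis.

Set Implicit Arguments.
Unset Strict Implicit.
Unset Printing Implicit Defensive.

Import Order.TTheory GRing.Theory Num.Theory.

(** The solid cube is [[-3/2, 3/2]^3], with the x axis pointing right, the y axis
  pointing up and the z axis pointing to the front (a right-handed frame).  A
  facelet has its centre at a point with two coordinates in {-1, 0, 1} and the
  remaining one equal to 3/2 or -3/2; that last coordinate is encoded as 2 or
  -2.  The coordinate c in {-2, ..., 2} is represented by c + 2 in ['I_5], so
  that [rev_ord] is the sign change c |-> -c. *)

Definition coord : Type := 'I_5.
Definition point : Type := (coord * coord * coord)%type.

Definition extreme (c : coord) : bool := (c == ord0) || (c == ord_max).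

Definition is_facelet (p : point) : bool :=
  count extreme [:: p.1.1; p.1.2; p.2] == 1%N.

Definition facelet : Type := {p : point | is_facelet p}.

Inductive face := Up | Down | Left | Right | Front | Back.

(** The nine cubies of a face, and hence its nine stickers and the twelve
  adjacent ones, are those with a positive (resp. negative) coordinate along
  the axis of that face. *)
Definition in_layer (f : face) (p : point) : bool :=
  let: (x, y, z) := p in
  match f with
  | Right => 2 < x
  | Left  => x < 2
  | Up    => 2 < y
  | Down  => y < 2
  | Front => 2 < z
  | Back  => z < 2
  end%N.

(** Rotation by a quarter turn about the axis of the face, clockwise for an
  observer who looks at that face from outside the cube. *)
Definition rotate (f : face) (p : point) : point :=
  let: (x, y, z) := p in
  match f with
  | Right => (x, z, rev_ord y)
  | Left  => (x, rev_ord z, y)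
  | Up    => (rev_ord z, y, x)
  | Down  => (z, y, rev_ord x)
  | Front => (y, rev_ord x, z)
  | Back  => (rev_ord y, x, z)
  end.

Definition turn_point (f : face) (p : point) : point :=
  if in_layer f p then rotate f p else p.

Lemma extreme_rev c : extreme (rev_ord c) = extreme c.
Proof. by case: c => [[|[|[|[|[|c]]]]] ltc]. Qed.

Lemma is_facelet_turn f p : is_facelet p -> is_facelet (turn_point f p).
Proof.
case: p => [[x y] z]; rewrite /turn_point; case: ifP => // _.
rewrite /is_facelet /=; case: f => /=; rewrite extreme_rev;
  by case: (extreme x); case: (extreme y); case: (extreme z).
Qed.

Lemma in_layer_rotate f p : in_layer f (rotate f p) = in_layer f p.
Proof. by case: f; case: p => [[x y] z]. Qed.

Lemma rotate_inj f : injective (rotate f).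
Proof.
apply: (can_inj (g := iter 3 (rotate f))) => -[[x y] z].
by case: f; rewrite /= !rev_ordK.
Qed.

Lemma turn_point_inj f : injective (turn_point f).
Proof.
move=> p q; rewrite /turn_point.
case: ifP => lp; case: ifP => lq //; first exact: rotate_inj.
- by move=> e; move: lq; rewrite -e in_layer_rotate lp.
- by move=> e; move: lp; rewrite e in_layer_rotate lq.
Qed.

Definition turn_facelet (f : face) (p : facelet) : facelet :=
  Sub (turn_point f (val p)) (is_facelet_turn f (valP p)).

Lemma turn_facelet_inj f : injective (turn_facelet f).
Proof.
by move=> p q e; apply/val_inj/(@turn_point_inj f)/(congr1 val e).
Qed.

(** The permutation sends the position of a sticker before the turn to its
  position after the turn. *)
Definition turn (f : face) : {perm facelet} := perm (@turn_facelet_inj f).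

Lemma card_facelet : #|{: facelet}| = 54.
Proof.
rewrite card_sig -sum1_card big_mkcond /=.
rewrite -(pair_big xpredT xpredT (fun a z =>
  if (a, z) \in [pred x | is_facelet x] then 1 else 0)) /=.
rewrite -(pair_big xpredT xpredT (fun x y => \sum_(z < 5)
  if (x, y, z) \in [pred x | is_facelet x] then 1 else 0)) /=.
by rewrite !big_ord_recl !big_ord0.
Qed.

Definition quarter_turns : {set {perm facelet}} :=
  [set turn Up; turn Down; turn Left; turn Right; turn Front; turn Back].

Definition half_turn_generators : {set {perm facelet}} :=
  (quarter_turns :|: [set X ^+ 2 | X in quarter_turns]
                 :|: [set X ^+ 3 | X in quarter_turns])%g.

Definition rubik_group : {group {perm facelet}} := <<quarter_turns>>%G.

Definition state : Type := [subg rubik_group].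

(** Permutations are multiplied in diagrammatic order, [(s * g) x = g (s x)], so
  the composite [g \o s] is [s * g]. *)
Definition rubik_adj : rel state :=
  fun g h => [exists s in half_turn_generators, sgval h == s * sgval g]%g.

(** The least length of a walk from [x] to [y].  A shortest walk has no repeated
  vertex, hence has length less than [#|T|]; if there is no walk at all, the
  value is [#|T|]. *)
Definition graph_dist (T : finType) (e : rel T) (x y : T) : nat :=
  find (fun k => [exists p : k.-tuple T, path e x p && (last x p == y)])
       (iota 0 #|T|).

Lemma graph_dist_le (T : finType) (e : rel T) (x : T) (p : seq T) :
  path e x p -> graph_dist e x (last x p) <= size p.
Proof.
move=> ep; rewrite /graph_dist leqNgt; apply/negP => lt_p.
have := before_find 0%N lt_p; have := leq_trans lt_p (find_size _ _).
rewrite size_iota => lt_pT; rewrite nth_iota // add0n => /existsP[].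
by exists (in_tuple p); rewrite /= ep eqxx.
Qed.

Lemma graph_dist_walk (T : finType) (e : rel T) (x y : T) :
  connect e x y ->
  exists p : seq T, [/\ path e x p, last x p = y & size p = graph_dist e x y].
Proof.
case/connectP=> p0 ep0 ->; case/shortenP: ep0 => p ep Up _.
have lt_pT : size p < #|T| by have := max_card (mem (x :: p)); rewrite (card_uniqP Up).
have lt_d := leq_ltn_trans (graph_dist_le ep) lt_pT.
have : has (fun k => [exists q : k.-tuple T, path e x q && (last x q == last x p)])
           (iota 0 #|T|) by rewrite has_find size_iota.
move/(nth_find 0%N); rewrite nth_iota // add0n => /existsP[q /andP[eq_ /eqP lq]].
by exists q; rewrite size_tuple.
Qed.

Definition graph_diameter (T : finType) (e : rel T) : nat :=
  \max_(x : T) \max_(y : T) graph_dist e x y.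

Definition rubik_dist (s : state) : nat := graph_dist rubik_adj s 1%g.

Definition rubik_diameter : nat := graph_diameter rubik_adj.

Local Open Scope classical_set_scope.
Local Open Scope ring_scope.

Section Sampling.
Context {R : realType} {d : measure_display} {Omega : measurableType d}.
Variables (P : probability Omega R) (I T : finType).
Implicit Types (Y : Omega -> T) (X : I -> Omega -> T).

(** Measurability of [Y] for the discrete sigma-algebra on [T]; it suffices to
  test singletons since [T] is finite. *)
Definition random_element Y : Prop :=
  forall t : T, measurable (Y @^-1` [set t]).

Definition uniformly_distributed Y : Prop :=
  forall t : T, P (Y @^-1` [set t]) = (#|T|%:R^-1)%:E.

Definition mutually_independent X : Prop :=
  forall (J : {set I}) (A : I -> {set T}),
    P (\bigcap_(i in [set` J]) (X i @^-1` [set` A i])) =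
    (\prod_(i in J) P (X i @^-1` [set` A i]))%E.

End Sampling.

Definition sample_mean (R : realType) (n : nat) (s : 'I_n -> state) : R :=
  (\sum_(i < n) (rubik_dist (s i))%:R) / n%:R.

(* Main.v *)
From Stdlib Require Import Ascii String.
From HB Require Import structures.
Require Import Defs.
From mathcomp Require Import all_boot all_order all_algebra all_fingroup.
From mathcomp Require Import all_classical all_reals all_analysis.
From mathcomp Require Import ring lra.

Import Order.TTheory GRing.Theory Num.Theory.
Local Open Scope classical_set_scope.
Local Open Scope ring_scope.

(** Let [mu] be the mean distance to the solved state.  Summing the triangle
  inequality [d x y <= d x z + d z y] over [z] and using the translation
  invariance of the distance gives [D <= 2 mu].  The event thus forces the
  empirical mean to lie at least [0.18] below [mu].  Chernoff's method with the
  quadratic bound [expR y <= 1 + y + 3/2 y^2] for [y <= 1/3], instead of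
  Hoeffding's lemma, reaches the constant [1541939] as soon as [D <= 182].

  We show [D <= 161] by exhibiting a stabilizer chain with a transversal of short
  words at each of its 18 levels.  Schreier's lemma reduces its completeness to
  the fact that finitely many products sift to the identity. *)

(** Membership in lists of words needs an equality on faces; it serves proofs only and is never
    computed with. *)
HB.instance Definition _ := gen_eqMixin face.

Section Diameter.
Local Open Scope nat_scope.
Local Open Scope group_scope.

(** * Words in the face turns *)

Definition move : Type := face * 'I_3.
Definition word : Type := seq move.

Definition move_perm (m : move) : {perm facelet} := turn m.1 ^+ m.2.+1.
Definition word_perm (w : word) : {perm facelet} := \prod_(m <- w) move_perm m.
(** The exponents [k.+1] and [(rev_ord k).+1] add up to 4, and [turn f ^+ 4 = 1]. *)
Definition inv_word (w : word) : word := rev [seq (m.1, rev_ord m.2) | m <- w].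

Lemma word_perm_nil : word_perm [::] = 1.
Proof. exact: big_nil. Qed.

Lemma word_perm_cons m w : word_perm (m :: w) = move_perm m * word_perm w.
Proof. exact: big_cons. Qed.

Lemma word_perm_cat w1 w2 : word_perm (w1 ++ w2) = word_perm w1 * word_perm w2.
Proof. exact: big_cat. Qed.

(** * Numbered stickers and permutations as tables *)

Definition coords : seq Defs.coord :=
  [:: @Ordinal 5 0 isT; @Ordinal 5 1 isT; @Ordinal 5 2 isT;
      @Ordinal 5 3 isT; @Ordinal 5 4 isT].

Definition stickers : seq Defs.point :=
  [seq p <- [seq (xy, z) | xy <- [seq (x, y) | x <- coords, y <- coords],
                           z <- coords] | is_facelet p].

Definition num (p : facelet) : nat := index (val p) stickers.

Lemma mem_stickers (p : facelet) : val p \in stickers.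
Proof.
have memC c : c \in coords.
  by case: c => [[|[|[|[|[|c]]]]] ltc] //; rewrite !inE -!val_eqE.
case: p => [[[x y] z] fp]; rewrite mem_filter; apply/andP; split=> //.
by apply: (allpairs_f pair) => //; apply: (allpairs_f pair).
Qed.

Lemma num_lt p : num p < size stickers.
Proof. by rewrite index_mem mem_stickers. Qed.

Lemma num_inj : injective num.
Proof.
move=> p q e; apply: val_inj; rewrite -(nth_index (val p) (mem_stickers p)).
by rewrite -/(num p) e nth_index ?mem_stickers.
Qed.

(* Simplification keeps the list of 54 points folded, while [vm_compute] still evaluates it. *)
Opaque stickers.

Definition table : Type := seq nat.

Definition tabulates (l : table) (g : {perm facelet}) : Prop :=
  size l = size stickers /\ forall p, nth 0 l (num p) = num (g p).

Definition mul_table (l1 l2 : table) : table := [seq nth 0 l2 k | k <- l1].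
Definition one_table : table := iota 0 (size stickers).

Lemma tabulates_inj l g h : tabulates l g -> tabulates l h -> g = h.
Proof.
move=> [_ lg] [_ lh]; apply/permP=> p; apply: num_inj.
exact: etrans (esym (lg p)) (lh p).
Qed.

Lemma tabulates_one : tabulates one_table 1.
Proof. by split=> [|p]; rewrite ?size_iota // nth_iota ?num_lt // perm1. Qed.

Lemma tabulates_mul l1 l2 g1 g2 :
  tabulates l1 g1 -> tabulates l2 g2 -> tabulates (mul_table l1 l2) (g1 * g2).
Proof.
move=> [s1 t1] [s2 t2]; split=> [|p]; first by rewrite size_map.
by rewrite (nth_map 0) ?s1 ?num_lt // t1 t2 permM.
Qed.

Definition turn_table (f : face) : table :=
  [seq index (turn_point f q) stickers | q <- stickers].

Lemma tabulates_turn f : tabulates (turn_table f) (turn f).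
Proof.
split=> [|p]; first by rewrite size_map.
by rewrite (nth_map (val p)) ?num_lt // nth_index ?mem_stickers // permE.
Qed.

Lemma turn4 f : turn f ^+ 4 = 1.
Proof.
have t := tabulates_turn f.
apply: tabulates_inj tabulates_one.
have := tabulates_mul _ _ _ _ t (tabulates_mul _ _ _ _ t (tabulates_mul _ _ _ _ t t)).
set l := mul_table _ _; suff -> : l = one_table by rewrite !expgS expg0 mulg1.
by rewrite /l; case: f {t l}; vm_compute.
Qed.

Lemma word_perm_inv w : word_perm (inv_word w) = (word_perm w)^-1.
Proof.
elim: w => [|[f k] w IH]; first by rewrite word_perm_nil invg1.
rewrite /inv_word /= rev_cons -cats1 word_perm_cat -/(inv_word w) IH.
rewrite !word_perm_cons word_perm_nil.
rewrite mulg1 invMg; congr (_ * _); apply/eqP; rewrite eq_sym eq_invg_mul /move_perm /=.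
by rewrite -expgD addnS subnKC // turn4.
Qed.

(** * Stabilizer chains and their verification by computation *)

(** A level [(b, gens, others)] of a stabilizer chain: [b] is the number of the
  base sticker; the words of [gens], together with those of the next levels,
  generate a subgroup fixing the base stickers of the previous levels; the words
  of [gens] and [others] map [b] to all the other points of its orbit. *)
Definition level : Type := (nat * seq word * seq word)%type.

(** An entry [(c, l)] consists of a point [c] of the orbit of [b] and the table [l] of
  an element that maps [c] back to [b].  Seven rounds complete the orbits of
  [rubik_chain]; with an incomplete orbit, [sift] would merely fail. *)
Definition orbit_step (V : seq (nat * table)) (r : table) :=
  foldl (fun W e => let c := index e.1 r in
    if has (fun e' => e'.1 == c) W then W else (c, mul_table r e.2) :: W) V V.

Definition orbit_tables (b : nat) (R : seq table) : seq (nat * table) :=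
  iter 7 (fun V => foldl orbit_step V R) [:: (b, one_table)].

(** Multiplies [l] by elements that bring the base stickers back one after the other;
  if the result is the identity, [l] belongs to the group of these elements. *)
Fixpoint sift (Vs : seq (nat * seq (nat * table))) (l : table) : bool :=
  if Vs is (b, V) :: Vs' then
    let c := nth 0 l b in
    sift Vs' (mul_table l (foldr (fun e l' => if e.1 == c then e.2 else l')
                                 one_table V))
  else l == one_table.

Section Check.
Variable turns : face -> table.

Definition word_table (w : word) : table :=
  foldr (fun (m : move) l => iter m.2.+1 (mul_table (turns m.1)) l) one_table w.

(** Schreier generators: with [t'] the representative that agrees with [t * r] on [b], the product
    [t * r * t'^-1] must sift through the next levels. Under call by value, [if] avoids sifting for
    the other [t'], which [&&] would not. *)
Definition check_level (b : nat) (R : seq table) Vs (T : seq (table * table)) :=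
  all (fun r => all (fun t => let l := mul_table t.1 r in
    has (fun t' => if nth 0 l b == nth 0 t'.1 b then sift Vs (mul_table l t'.2)
                   else false) T) T) R.

(** Returns the verdict, the generators' tables and the tables for [sift]. The short words in [T]
    decide the length bound; the orbit tables only certify membership, so they may stand for long
    words. *)
Fixpoint check_chain (c : seq level) :=
  if c is (b, gens, others) :: c' then
    let: (ok, R', Vs) := check_chain c' in
    let R := [seq word_table w | w <- gens] ++ R' in
    let T := [seq (word_table w, word_table (inv_word w))
               | w <- [::] :: gens ++ others] in
    (ok && check_level b R Vs T, R, (b, orbit_tables b R) :: Vs)
  else (true, [::], [::]).

(** The last condition puts the six quarter turns, hence the whole cube group, into the group of the
    chain. *)
Definition check_all (c : seq level) : bool :=
  let: (ok, _, Vs) := check_chain c in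
  ok && all (fun f => sift Vs (turns f)) [:: Up; Down; Left; Right; Front; Back].

End Check.

(** An element is a product of one transversal word per level, so the maximal lengths of the levels
    add up. *)
Definition chain_length (c : seq level) : nat :=
  sumn [seq foldr maxn 0 [seq size w | w <- l.1.2 ++ l.2] | l <- c].

Definition face_of_ascii (c : ascii) : face :=
  match c with
  | "U" => Up | "D" => Down | "L" => Left | "R" => Right | "F" => Front
  | _ => Back
  end%char.

(** ["UR2F3"] stands for the moves [U], [R^2] and [F^3], in this order. *)
Fixpoint word_of_string (s : string) : word :=
  if s is String c s' then
    let f := face_of_ascii c in
    match s' with
    | String "2" s'' => (f, @Ordinal 3 1 isT) :: word_of_string s''
    | String "3" s'' => (f, @Ordinal 3 2 isT) :: word_of_string s''
    | _ => (f, @Ordinal 3 0 isT) :: word_of_string s'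
    end%char
  else [::].

(** Found by a computer search; a base sticker of a corner or an edge per level,
  the corners first. *)
Definition rubik_chain_strings : seq (nat * seq string * seq string) :=
[::
  (33, [:: "D"], [:: "D2"; "D3"; "R"; "R2"; "R3"; "B"; "B2"; "B3"; "DL";
     "DL2"; "DL3"; "D2L"; "D2L3"; "D2F3"; "D3R"; "D3R3"; "RD"; "RD3"; "R2U3";
     "R2F3"; "R3U"; "R3U3"]);
  (2, [:: "L"], [:: "L2"; "L3"; "F"; "F2"; "F3"; "L2U"; "L2U3"; "L3U"; "L3U2";
     "L3U3"; "L3F2"; "L3F3"; "FU"; "FU2"; "FU3"; "FL"; "FL2"; "L2U3F2"; "FUL3"]);
  (6, [:: "U"], [:: "U2"; "U3"; "LUL3"; "LU2L3"; "LU3L3"; "LFL3"; "LF2L3";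
     "L2F3L2"; "F2L3F2"; "F3L2F"; "ULU2L3"; "LU2L3U2"; "LU2L3U3"; "LU3FL3";
     "LFU2L3"; "LFL3U3"]);
  (40, [:: "UF3U3F"], [:: "U3LFL3"; "LF3L3U"; "L2U2F2U2"; "L2F2L2U2";
     "L3ULF3"; "FL3U3L"; "F2U2L2U2"; "F3UFU3"; "ULF2L3U3"; "UL2F3L2U3";
     "UF2LF2U3"; "U3LU2FL3"; "LF3U2L3U"]);
  (35, [:: "FULU3F2"], [:: "FL3FLF3"; "FL3F2LF3"; "F2UL3U3F3"; "F2L3FLF";
     "F3L3F3LF2"; "U3L2UL2UF2"; "LF2L3F2L3F2"; "F2LU3F3UF2"; "U3F3UFLFL3";
     "LF3L3F3U3FU"]);
  (8, [:: "UF3U3LULFU2"], [:: "ULU3L3F3LF"; "F3L3FLUL3U3"; "UF3LFLUL3U2";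
     "U2LU3L3F3L3FU3"; "U2F3L3U3L3UFU3"; "LU2L3U3F3L2FU"; "LU2FUF3U3L3U2"]);
  (0, [:: "UF2U3L2UL3F2LF2L3"; "LUL3U2LF3LFL2U2"], [:: "LF2L3F2LU3L2UF2U3";
     "FUL3U2LU3FLF2U2"; "FUL3F2LF3LUF2L2"]);
  (29, [:: "ULDU3F3D3"], [:: "ULR3F3RL3"; "UL3DU3FD3"; "U2BD2U2F3D2";
     "U2B3D2U2FD2"; "U3RD3UF3D"; "DL2R2U3R2L2"; "DFUD3L3U3"; "D2L2R2B2F2U2";
     "D2F2L2R2F2U2"; "D2F3U2D2BU2"; "D3L2R2UR2L2"; "D3FU3DR3U"; "LR3FRL3U3";
     "L2R2UR2L2D3"; "L2R2DR2L2U3"; "L2R2D3R2L2U"; "UDLUD3B3U2";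
     "U2BDU3L3D3U3"; "U3R3D2U2LD2U3"; "LR2D3L3RFR"; "L2DRL3F3R3L3";
     "UD3LUD3B2D2U2F"]);
  (43, [:: "UD3FDU3R3"], [:: "UFDU3R3D3"; "UF3DU3RD3"; "U2LD2U2R3D2";
     "U2L3D2U2RD2"; "U3BD3UR3D"; "DRUD3F3U3"; "DF2B2U3B2F2"; "D2R3U2D2LU2";
     "D3RU3DB3U"; "D3F2B2UB2F2"; "L2FB3U2BF3"; "FB3UBF3L3"; "FB3U2BF3L2";
     "FB3D2BF3R2"; "BLFB3U3F3"; "UDFUD3L3U2"; "U2LDU3F3D3U3"; "U3B3D2U2FD2U3";
     "LRBL3RD3R2"; "UD3FUD3L2D2U2R"]);
  (1%N, [:: "U2D2RD2U2L3"], [:: "U2D2R3D2U2L"; "U3DF3D3UL"; "U3LD3UB3D";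
     "U3L3D3UBD"; "DLR3B3RL3"; "D2FB3L2BF3"; "D3BU3DL3U"; "LUD3B3DU3";
     "LU2D2R3D2U2"; "LR3BRL3D3"; "FB3L2BF3D2"; "U2DFU2D2B3D"; "DLR3BRL3D2";
     "D3LR3B2RL3D3"; "D3B3D3URD2U3"; "D2RB3U2D2FL3U2"; "LUD3R3DU3BL3";
     "UD3B3UD3R2D2U2L3"]);
  (34, [:: "URDU3B3D3"], [:: "U2R3D2U2LD2"; "DBUD3R3U3"; "DB3UD3RU3";
     "D2LU2D2R3U2"; "D2L3U2D2RU2"; "L3D3R3LBR"; "UDBUD3R3U2"; "UDBU3DL3D2";
     "U2D3FDU3R3U3"; "U2D3F3U2D2BD3"; "UF2L2B2L2F2R2U3"; "U2LDRL3F3R3U2";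
     "U2F2L2B2R2B2L2U2"; "D2L3BU2D2F3RU2"; "D2F3LU2D2R3BU2";
     "UR3UD3F2D2U2B3D3"]);
  (23, [:: "U2FD2U2B3D2"], [:: "U2F3D2U2BD2"; "U3FD3UL3D"; "D2LR3B2RL3";
     "D2BU2D2F3U2"; "D2B3U2D2FU2"; "D3LU3DF3U"; "LR3B2RL3D2"; "L3RDR3LB3";
     "B3L3RDR3L"; "UDRUD3F3U2"; "UDRU3DB3D2"; "D3L3D3UBD2U3"; "D3FB3L2BF3D3";
     "U3FU2D2B2DU3LD"]);
  (28, [:: "UD3RDU3B3"], [:: "UD3R3DU3B"; "U2D2FD2U2B3"; "U2D2F3D2U2B";
     "U3DLD3UB3"; "BUD3R3DU3"; "B3U2D2FD2U2"; "LF2R2B2R2F2L"; "UD3RD3UF3D2U2";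
     "U3DL3U2D2RDU3"; "DB3L3UD3BRU3"; "LB3U2D2FR3D2U2"; "UD3RUD3F2D2U2B"]);
  (7, [:: "UBDU3L3D3"], [:: "UB3DU3LD3"; "DLUD3B3U3"; "UBUD3R3DU2";
     "U2D3RU2D2L3D3"; "U2D3R3DU3BU3"; "U3D2FD2U2B3U3"; "U3D2F3D2U2BU3";
     "DL3D2U2RDU2"; "ULRB2L3R3U2L2U"; "UBUD3R2D2U2LD3"]);
  (39, [:: "UF2DU3R2D3"], [:: "DR2UD3F2U3"; "DF2UD3L2U3"; "FLR3D2RL3F";
     "DL3U2B2D2R3U2F2D"; "UBR2BDU3L3B2L3D3"; "DL3F2LUD3B3L2BU3";
     "FU2BL3RD3R3LU2F3"; "BU3DLU2D2R3D3UF3D2U2"]);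
  (21, [:: "D2BR2U2L2FU2R2"], [:: "R2U2FL2U2R2BD2"; "R2U2F3L2U2R2B3D2";
     "DLD2F2U2RU2F2D"; "DF2U2L3D2B2U2R3D"; "D3F2U2R3U2F2D2L3D3";
     "BD3U3LUD3B3D2B3L3RD3R3LB"]);
  (3, [:: "UB2DU3L2D3"], [:: "DL2UD3B2U3"; "L2FUD3L3B2LDU3F3";
     "B2LF3BD3B2DB3FL3"; "L2FUD3L3B2LDU3F3DL2UD3B2U3"]);
  (38, [:: "D3RD2LU3DF3DUR3D2L3UD3BU3"], [::])]%string.

Definition rubik_chain : seq level :=
  [seq (l.1.1, map word_of_string l.1.2, map word_of_string l.2)
    | l <- rubik_chain_strings].

(** The local definitions make the machine compute each table only once. *)
Definition memo_turns : face -> table :=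
  let u := turn_table Up in let d := turn_table Down in
  let l := turn_table Left in let r := turn_table Right in
  let f := turn_table Front in let b := turn_table Back in
  fun x => match x with
           | Up => u | Down => d | Left => l | Right => r | Front => f | Back => b
           end.

Lemma rubik_chain_checked : check_all memo_turns rubik_chain.
Proof. by vm_compute. Qed.

(** * Soundness of the verification *)

Definition table_in (A : {set {perm facelet}}) (l : table) : Prop :=
  exists2 g, g \in A & tabulates l g.

Lemma table_in_sub (A B : {set {perm facelet}}) l :
  A \subset B -> table_in A l -> table_in B l.
Proof. by move=> /fintype.subsetP sAB [g /sAB Bg lg]; exists g. Qed.

Lemma table_in_mul (A : {group {perm facelet}}) l1 l2 :
  table_in A l1 -> table_in A l2 -> table_in A (mul_table l1 l2).
Proof.
move=> [g Ag lg] [h Ah lh].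
by exists (g * h); [rewrite groupM | apply: tabulates_mul].
Qed.

Lemma table_in_one (A : {group {perm facelet}}) : table_in A one_table.
Proof. by exists 1; [rewrite group1 | apply: tabulates_one]. Qed.

Lemma foldl_ind (S : Type) (T : eqType) (f : S -> T -> S) (Q : S -> Prop) (x : S)
    (s : seq T) :
  Q x -> (forall y z, z \in s -> Q y -> Q (f y z)) -> Q (foldl f x s).
Proof.
elim: s x => //= z s IH x Qx Qf; apply: IH => [|y t ts Qy]; apply: Qf => //.
  exact: mem_head.
by rewrite inE ts orbT.
Qed.

(* Schreier: the condition makes the union of the cosets [B * t] stable under right
  multiplication by the elements of [X]. *)
Lemma gen_coset_cover (gT : finGroupType) (X : {set gT}) (B : {group gT})
    (T : seq gT) :
  1 \in T ->
  (forall r t, r \in X -> t \in T -> exists2 t', t' \in T & t * r * t'^-1 \in B) ->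
  forall g, g \in <<X>> -> exists2 t, t \in T & g * t^-1 \in B.
Proof.
move=> T1 TX g /gen_prodgP[n [c Xc ->]]; elim: n c Xc => [|n IH] c Xc.
  by exists 1; rewrite // big_ord0 invg1 mulg1 group1.
rewrite big_ord_recr /=; set h := \prod_(i < n) _.
have [t Tt Bht] : exists2 t, t \in T & h * t^-1 \in B by apply: IH.
have [t' Tt' Bt'] := TX _ _ (Xc ord_max) Tt; exists t' => //.
by rewrite -(groupMr _ Bt') in Bht; rewrite -!mulgA mulKg !mulgA in Bht.
Qed.

Section Group.
Variable A : {group {perm facelet}}.

Lemma orbit_step_in (V : seq (nat * table)) r :
  table_in A r -> (forall e, e \in V -> table_in A e.2) ->
  forall e, e \in orbit_step V r -> table_in A e.2.
Proof.
move=> Ar AV; rewrite /orbit_step.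
apply: (foldl_ind _ _ _ (fun W => forall e, e \in W -> table_in A e.2)) => //.
move=> W e eV AW e' /=; case: ifP => _; first exact: AW.
by rewrite inE => /predU1P[-> /=|/AW//]; apply: table_in_mul => //; apply: AV.
Qed.

Lemma orbit_tables_in b R :
  (forall r, r \in R -> table_in A r) ->
  forall e, e \in orbit_tables b R -> table_in A e.2.
Proof.
move=> AR; rewrite /orbit_tables; elim: 7 => [|n IH] /=.
  by move=> e; rewrite inE => /eqP->; apply: table_in_one.
apply: (foldl_ind _ _ _ (fun W => forall e, e \in W -> table_in A e.2)) => //.
by move=> W r rR AW; apply: orbit_step_in => //; apply: AR.
Qed.

(** Each round multiplies by an element of [A], which does not affect membership in [A], and the
    last product is the identity. *)
Lemma sift_in (Vs : seq (nat * seq (nat * table))) l g :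
  (forall V, V \in Vs -> forall e, e \in V.2 -> table_in A e.2) ->
  tabulates l g -> sift Vs l -> g \in A.
Proof.
elim: Vs l g => [|[b V] Vs IH] l g AVs lg /=.
  by move=> /eqP l1; rewrite {l}l1 in lg; rewrite (tabulates_inj _ _ _ lg tabulates_one).
set v := foldr _ _ _ => sv.
have [h Ah vh] : table_in A v.
  have := AVs (b, V) (mem_head _ _) => /=; rewrite /v; elim: (V) => [|e V' IHV] /= AV.
    exact: table_in_one.
  case: ifP => _; first by apply: AV; rewrite mem_head.
  by apply: IHV => e' e'V; apply: AV; rewrite inE e'V orbT.
rewrite -(groupMr g Ah); apply: IH sv; last exact: tabulates_mul.
by move=> W WVs; apply: AVs; rewrite inE WVs orbT.
Qed.
End Group.

Section Check.
Variable turns : face -> table.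
Hypothesis turnsP : forall f, tabulates (turns f) (turn f).

Lemma word_tableP w : tabulates (word_table turns w) (word_perm w).
Proof.
elim: w => [|[f k] w IH]; first by rewrite word_perm_nil; apply: tabulates_one.
rewrite word_perm_cons /move_perm /=; elim: {k}(k : nat) => [|k IHk] /=.
  by rewrite expg1; exact: tabulates_mul (turnsP f) IH.
by rewrite expgS -mulgA; exact: tabulates_mul (turnsP f) IHk.
Qed.

Definition chain_group (c : seq level) : {group {perm facelet}} :=
  <<[set g in [seq word_perm w | w <- flatten [seq l.1.2 | l <- c]]]>>%G.

(** Induction from the deepest level upwards: the group of a level is covered by the cosets [B * t],
    with [B] the group of the next levels and [t] in the transversal. *)
Lemma check_chainP (c : seq level) :
  let: (ok, R, Vs) := check_chain turns c in ok ->
  [/\ R = [seq word_table turns w | w <- flatten [seq l.1.2 | l <- c]],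
      forall V, V \in Vs -> forall e, e \in V.2 -> table_in (chain_group c) e.2
    & forall g, g \in chain_group c ->
        exists2 w, word_perm w = g & size w <= chain_length c].
Proof.
elim: c => [|[[b gens] others] c IH].
  move=> _; split=> // g; rewrite /chain_group /=.
  have -> : [set x in [::]] = finset.set0 :> {set {perm facelet}}.
    by apply/finset.setP=> x; rewrite !inE.
  by rewrite gen0 => /finset.set1P->; exists [::]; rewrite ?word_perm_nil.
set A := chain_group (_ :: _); rewrite /=.
case: (check_chain turns c) IH => [[ok R'] Vs] IH /andP[/IH {IH}[eR AVs lenc] chk].
have sA : chain_group c \subset A.
  apply: genS; apply/fintype.subsetP=> x; rewrite !inE /= map_cat mem_cat => ->.
  by rewrite orbT.
have eR2 : [seq word_table turns w | w <- gens] ++ R' =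
   [seq word_table turns w | w <- flatten [seq l.1.2 | l <- (b, gens, others) :: c]].
  by rewrite /= map_cat eR.
split=> //.
  move=> V; rewrite inE => /predU1P[->|/AVs AV] /=; last first.
    by move=> e /AV; apply: table_in_sub.
  apply: orbit_tables_in => r; rewrite eR2 => /mapP[w wc ->].
  by exists (word_perm w); [apply: mem_gen; rewrite inE map_f | apply: word_tableP].
move=> g Ag; set T := [seq word_perm w | w <- [::] :: gens ++ others].
have [||t /mapP[w wT ->]] := gen_coset_cover _ _ (chain_group c) T _ _ g Ag.
- by rewrite /T /= word_perm_nil mem_head.
- move=> x y; rewrite inE => /mapP[r rc ->] /mapP[t tT ->].
  have /allP/(_ (word_table turns r)) := chk.
  rewrite eR2 map_f // => /(_ isT)/allP.
  move=> /(_ _ (map_f (fun w => (word_table turns w, word_table turns (inv_word w))) tT)).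
  move=> /hasP[_ /(@mapP _ _ _ ([::] :: gens ++ others))[t' tT' ->]] /=.
  case: ifP => // _ st.
  exists (word_perm t'); first exact: map_f.
  rewrite -word_perm_inv; apply: (sift_in _ _ _ _ AVs _ st).
  by do 2?apply: tabulates_mul; apply: word_tableP.
(* The element [g * t^-1] of the smaller group has a word [w']; appending the word of [t] gives
   [g]. *)
move=> /lenc[w' ew' sw']; exists (w' ++ w).
  by rewrite word_perm_cat ew' mulgKV.
rewrite size_cat addnC leq_add //=.
move: wT; rewrite inE => /predU1P[-> //|]; elim: (gens ++ others) => //= x s IHs.
by rewrite inE leq_max => /predU1P[->|/IHs->]; rewrite ?leqnn ?orbT.
Qed.

Lemma check_allP (c : seq level) : check_all turns c ->
  forall g, g \in rubik_group -> exists2 w, word_perm w = g & size w <= chain_length c.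
Proof.
rewrite /check_all; have := check_chainP c.
case: (check_chain turns c) => [[ok R] Vs] cP /andP[/cP{cP}[_ AVs lenc] chk] g Gg.
apply: lenc; apply: fintype.subsetP Gg; rewrite gen_subG; apply/fintype.subsetP => x.
have Af f : sift Vs (turns f) -> turn f \in chain_group c by exact: sift_in.
move: chk => /= /andP[u /andP[d /andP[l /andP[r /andP[f /andP[b _]]]]]].
by rewrite !inE -!orbA => /or4P[||| /or3P[]] /eqP->; apply: Af.
Qed.
End Check.

Lemma memo_turnsP f : tabulates (memo_turns f) (turn f).
Proof. by case: f; apply: tabulates_turn. Qed.

Lemma rubik_word g : g \in rubik_group -> exists2 w, word_perm w = g & size w <= 161.
Proof.
move=> /(check_allP _ memo_turnsP _ rubik_chain_checked)[w ew sw].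
(* [chain_length rubik_chain] evaluates to 161. *)
by exists w.
Qed.

(** * Distances in the Cayley graph *)

Lemma move_perm_gen (m : move) : move_perm m \in half_turn_generators.
Proof.
case: m => f k; rewrite /move_perm /= /half_turn_generators 2!finset.in_setU.
have Qf : turn f \in quarter_turns by case: f; rewrite !inE eqxx ?orbT.
have Qk n : turn f ^+ n \in [set X ^+ n | X in quarter_turns]%SET.
  by apply/imsetP; exists (turn f).
case: k => [[|[|[|k]]] ltk] //.
- by rewrite expg1 Qf.
- by rewrite Qk orbT.
- by rewrite Qk orbT.
Qed.

Lemma half_turn_sub : half_turn_generators \subset rubik_group.
Proof.
apply/fintype.subsetP=> x; rewrite 2!finset.in_setU.
by case/orP=> [/orP[Qx|/imsetP[y Qy ->]]|/imsetP[y Qy ->]]; rewrite ?groupX ?mem_gen.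
Qed.

(** Adjacency multiplies on the left, so the walk makes the last move of [w] first and the head of
    [w] extends the walk at its end. *)
Lemma word_path w (x : state) : exists p : seq state,
  [/\ path rubik_adj x p, sgval (last x p) = word_perm w * sgval x & size p = size w].
Proof.
elim: w => [|m w [p [xp lp sp]]].
  by exists [::]; rewrite /= word_perm_nil mul1g.
have Gm : move_perm m \in rubik_group.
  by apply: (fintype.subsetP half_turn_sub); apply: move_perm_gen.
exists (rcons p (subg rubik_group (move_perm m) * last x p)).
rewrite last_rcons rcons_path size_rcons sp; split=> //.
  rewrite xp; apply/existsP; exists (move_perm m).
  by rewrite move_perm_gen sgvalM ?finset.in_setT // subgK ?eqxx.
by rewrite sgvalM ?finset.in_setT // subgK // lp word_perm_cons mulgA.
Qed.

Lemma rubik_path (x y : state) : exists2 p : seq state,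
  path rubik_adj x p /\ last x p = y & size p <= 161.
Proof.
have Gyx : sgval y * (sgval x)^-1 \in rubik_group by rewrite groupM ?groupV ?subgP.
have [w ew sw] := rubik_word _ Gyx; have [p [xp lp sp]] := word_path w x.
exists p; rewrite ?sp //; split=> //.
by apply: subg_inj; rewrite lp ew mulgKV.
Qed.

Lemma rubik_connect (x y : state) : connect rubik_adj x y.
Proof. by have [p [xp <-] _] := rubik_path x y; apply/connectP; exists p. Qed.

Lemma rubik_adj_dist_le (x y : state) : graph_dist rubik_adj x y <= 161.
Proof.
have [p [xp <-]] := rubik_path x y; apply: leq_trans; exact: graph_dist_le.
Qed.

Lemma graph_dist_triangle (T : finType) (e : rel T) (x y z : T) :
  connect e x y -> connect e y z ->
  graph_dist e x z <= graph_dist e x y + graph_dist e y z.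
Proof.
move=> /graph_dist_walk[p [ep <- <-]] /graph_dist_walk[q [eq <- <-]].
by rewrite -size_cat -last_cat graph_dist_le // cat_path ep.
Qed.

(** Right translation commutes with left multiplication by generators, so it maps walks to walks. *)
Lemma rubik_dist_translate (x y t : state) :
  graph_dist rubik_adj (x * t) (y * t) <= graph_dist rubik_adj x y.
Proof.
have [p [xp <- <-]] := graph_dist_walk (rubik_connect x y).
rewrite -(size_map (mulg^~ t)) -(last_map (mulg^~ t)) graph_dist_le //.
rewrite (path.path_map (f := mulg^~ t)); apply: sub_path xp => g h.
move=> /existsP[s /andP[Ss /eqP gh]].
by apply/existsP; exists s; rewrite Ss !sgvalM ?finset.in_setT // gh mulgA eqxx.
Qed.

Lemma rubik_dist_div (x y : state) : graph_dist rubik_adj x y <= rubik_dist (x * y^-1).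
Proof. by have := rubik_dist_translate (x * y^-1) 1 y; rewrite mulgKV mul1g. Qed.

(* Sum the triangle inequality through [z] over all [z]. *)
Lemma rubik_diameter_mean :
  #|{: state}| * rubik_diameter <= 2 * \sum_(z : state) rubik_dist z.
Proof.
rewrite mulnC -leq_divRL; last by apply/card_gt0P; exists 1.
apply/bigmax_leqP=> x _; apply/bigmax_leqP=> y _.
rewrite leq_divRL; last by apply/card_gt0P; exists 1.
rewrite mulnC -sum_nat_const mul2n -addnn.
(* Both [x * z^-1] and [z * y^-1] run over all states as [z] does, so each half of the triangle
   inequality sums to the total distance. *)
have inj_x : injective (fun z : state => x * z^-1) by move=> z1 z2 /mulgI/invg_inj.
have sum_x : \sum_(z : state) rubik_dist z = \sum_(z : state) rubik_dist (x * z^-1)%g.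
  exact: reindex_inj inj_x.
have sum_y : \sum_(z : state) rubik_dist z = \sum_(z : state) rubik_dist (z * y^-1)%g.
  exact: reindex_inj (mulIg y^-1).
rewrite [leqRHS](congr2 addn sum_x sum_y) -big_split /=.
apply: leq_sum => z _; apply: leq_trans (graph_dist_triangle _ _ x z y _ _) _.
- exact: rubik_connect.
- exact: rubik_connect.
by apply: leq_add; apply: rubik_dist_div.
Qed.

End Diameter.

(** * Exponential moments of a bounded function *)

(** From [1 - y <= expR (- y)] comes [expR y <= 1 / (1 - y)]; the quadratic times [1 - y] exceeds 1
    by [y ^+ 2 * (1 / 2 - 3 / 2 * y)]. *)
Lemma expR_le_quadratic (R : realType) (y : R) :
  y <= 1 / 3 -> expR y <= 1 + y + 3 / 2 * y ^+ 2.
Proof.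
move=> y3; have y1 : 0 < 1 - y by lra.
have := expR_ge1Dx (- y); rewrite expRN => le_inv.
have e0 := expR_gt0 y.
have : expR y * (1 - y) <= 1.
  by rewrite -[leRHS](mulfV (lt0r_neq0 e0)) ler_wpM2l // ltW.
rewrite -ler_pdivlMr // => /le_trans; apply; rewrite ler_pdivrMr //.
have : 0 <= y ^+ 2 * (1 / 2 - 3 / 2 * y) by rewrite mulr_ge0 ?sqr_ge0 //; lra.
rewrite -(subr_ge0 1).
suff -> : (1 + y + 3 / 2 * y ^+ 2) * (1 - y) - 1 = y ^+ 2 * (1 / 2 - 3 / 2 * y) by [].
by field.
Qed.

Section FiniteMean.
Variables (R : realType) (T : finType) (f : T -> R) (M : R).
Hypotheses (T_gt0 : (0 < #|T|)%N) (f_ge0 : forall t, 0 <= f t)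
  (f_le : forall t, f t <= M).

Let mean : R := (\sum_t f t) / #|T|%:R.

Let card_gt0 : 0 < #|T|%:R :> R. Proof. by rewrite ltr0n. Qed.

Lemma sum_deviation : \sum_t (mean - f t) = 0.
Proof.
by rewrite sumrB sumr_const -[_ *+ _]mulr_natr divfK ?subrr // gt_eqF.
Qed.

(* [f ^+ 2 <= M f] gives the variance bound [mean (M - mean) <= M ^+ 2 / 4]. *)
Lemma sum_deviation_sqr_le : \sum_t (mean - f t) ^+ 2 <= #|T|%:R * (M ^+ 2 / 4).
Proof.
apply: (@le_trans _ _ (\sum_t ((M - 2 * mean) * f t + mean ^+ 2))).
  apply: ler_sum => t _.
  have : 0 <= f t * (M - f t) by rewrite mulr_ge0 ?subr_ge0.
  nra.
rewrite big_split /= -mulr_sumr sumr_const -(mulr_natr (mean ^+ 2)).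
have -> : \sum_t f t = mean * #|T|%:R by rewrite divfK // gt_eqF.
rewrite mulrA -mulrDl mulrC ler_wpM2l ?ler0n //.
have : 0 <= (mean - M / 2) ^+ 2 by exact: sqr_ge0.
nra.
Qed.

(** In the averaged quadratic bound the linear term cancels, and the variance bound turns 3/2 into
    3/8; then [1 + u <= expR u]. *)
Lemma mgf_deviation_le (a : R) : 0 <= a -> a * M <= 1 / 3 ->
  \sum_t #|T|%:R^-1 * expR (a * (mean - f t)) <= expR (3 / 8 * (a * M) ^+ 2).
Proof.
move=> a0 aM; apply: le_trans (expR_ge1Dx _); rewrite -mulr_sumr.
rewrite ler_pdivrMl //.
have mean_le : mean <= M.
  by rewrite ler_pdivrMr // mulr_natr -sumr_const ler_sum.
apply: (@le_trans _ _ (\sum_t (1 + a * (mean - f t) +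
                          3 / 2 * a ^+ 2 * (mean - f t) ^+ 2))).
  apply: ler_sum => t _; rewrite -mulrA -exprMn; apply: expR_le_quadratic.
  apply: le_trans aM; rewrite ler_wpM2l // lerBlDr.
  by apply: le_trans mean_le _; rewrite lerDl.
rewrite !big_split /= -!mulr_sumr sum_deviation mulr0 addr0 sumr_const.
have := sum_deviation_sqr_le; set V := \sum_t _ => leV.
have : a ^+ 2 * V <= a ^+ 2 * (#|T|%:R * (M ^+ 2 / 4)) by rewrite ler_wpM2l ?sqr_ge0.
nra.
Qed.
End FiniteMean.

(** * Lower tail of a uniform independent sample *)

Section UniformSample.
Variables (R : realType) (d : measure_display) (Omega : measurableType d)
  (P : probability Omega R) (I T : finType) (X : I -> Omega -> T).
Hypotheses (X_random : forall i, random_element (X i))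
  (X_uniform : forall i, uniformly_distributed P (X i))
  (X_indep : mutually_independent P X).

Let atom (s : {ffun I -> T}) : set Omega := [set w | forall i, X i w = s i].

Let atomE s :
  atom s = \bigcap_(i in [set` [set: I]%SET]) (X i @^-1` [set` [set s i]%SET]).
Proof.
apply/seteqP; split=> w /= aw i; first by move=> _ /=; rewrite aw inE.
by have := aw i; rewrite /= !inE => /(_ isT)/eqP.
Qed.

Let preimage_singleton i t : X i @^-1` [set` [set t]%SET] = X i @^-1` [set t].
Proof. by apply/seteqP; split=> w /=; rewrite inE => /eqP. Qed.

Let measurable_atom s : measurable (atom s).
Proof.
rewrite atomE; apply: fin_bigcap_measurable => [|i _]; first exact: finite_finset.
by rewrite preimage_singleton; apply: X_random.
Qed.

Lemma sample_atom s : P (atom s) = (\prod_(i : I) (#|T|%:R^-1 : R))%:E.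
Proof.
rewrite atomE X_indep -prodEFin; apply: eq_big => [i|i _]; first by rewrite inE.
by rewrite preimage_singleton X_uniform.
Qed.

(** The event is a finite disjoint union of atoms, so probabilities become finite sums and no
    integration is involved. *)
Lemma sample_event (B : {pred {ffun I -> T}}) :
  P [set w | B [ffun i => X i w]] = (\sum_(s in B) \prod_(i : I) (#|T|%:R^-1 : R))%:E.
Proof.
have -> : [set w | B [ffun i => X i w]] = \bigcup_(s in [set` B]) atom s.
  apply/seteqP; split=> [w Bw|w [s Bs aw]].
    by exists [ffun i => X i w] => //= i; rewrite ffunE.
  by rewrite /=; have -> : [ffun i => X i w] = s by apply/ffunP=> i; rewrite ffunE aw.
rewrite measure_fin_bigcup //; last first.
  apply/trivIsetP => s1 s2 _ _ /eqP ns; apply/seteqP; split=> // w [/= a1 a2].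
  by apply: ns; apply/ffunP=> i; rewrite -a1 a2.
have -> : [set` B] = [set` enum B] by apply/seteqP; split=> s /=; rewrite mem_enum.
rewrite -fsbig_seq ?enum_uniq // big_enum -sumEFin.
by apply: eq_bigr => s _; apply: sample_atom.
Qed.

(* Chernoff bound, with the exponent [a = 4 eps / (3 M ^+ 2)]. *)
Lemma uniform_lower_tail (f : T -> R) (M eps c : R) :
  (0 < #|T|)%N -> (forall t, 0 <= f t) -> (forall t, f t <= M) ->
  0 < M -> 0 <= eps -> 4 * eps <= M ->
  c <= #|I|%:R * ((\sum_t f t) / #|T|%:R - eps) ->
  (P [set w | (\sum_i f (X i w) <= c)%R]
   <= (expR (- (#|I|%:R * (2 * eps ^+ 2 / (3 * M ^+ 2)))))%:E)%E.
Proof.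
move=> T_gt0 f_ge0 f_le M0 eps0 epsM; set mean := _ / _ => c_le.
pose B : {pred {ffun I -> T}} := fun s => \sum_i f (s i) <= c.
have -> : [set w | \sum_i f (X i w) <= c] = [set w | B [ffun i => X i w]].
  have BE w : B [ffun i => X i w] = (\sum_i f (X i w) <= c).
    by rewrite /B; under eq_bigr do rewrite ffunE.
  by apply/seteqP; split=> w /=; rewrite BE.
rewrite sample_event lee_fin; set a := 4 * eps / (3 * M ^+ 2).
have a0 : 0 <= a by rewrite /a divr_ge0 // mulr_ge0 // sqr_ge0.
have aM : a * M = 4 * eps / (3 * M) by rewrite /a; field; rewrite gt_eqF.
have aM3 : a * M <= 1 / 3.
  rewrite aM ler_pdivrMr ?mulr_gt0 //; have -> : 1 / 3 * (3 * M) = M by field.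
  by [].
pose E := expR (- (a * (#|I|%:R * eps))).
(* Markov's inequality: [E] times the product of exponentials is at least 1 on [B] and nonnegative
   elsewhere. *)
apply: (@le_trans _ _ (E * \sum_(s : {ffun I -> T})
    \prod_i (#|T|%:R^-1 * expR (a * (mean - f (s i)))))).
  rewrite mulr_sumr [leRHS](bigID (mem B)) /= -[leLHS]addr0 lerD //; last first.
    by apply: sumr_ge0 => s _; rewrite mulr_ge0 ?expR_ge0 // prodr_ge0 // => i _;
       rewrite mulr_ge0 ?expR_ge0 ?invr_ge0.
  apply: ler_sum => s Bs; rewrite big_split /= mulrCA -[leLHS]mulr1.
  rewrite ler_wpM2l ?prodr_ge0 // -expR_sum -expRD -[leLHS]expR0 ler_expR.
  rewrite -mulr_sumr sumrB sumr_const -[mean *+ _]mulr_natl addrC subr_ge0.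
  rewrite ler_wpM2l // lerBrDr -lerBrDl -mulrBr.
  exact: le_trans Bs c_le.
(* Independence: the sum over samples factors into one sum per index. *)
rewrite -(bigA_distr_bigA (fun (i : I) t => #|T|%:R^-1 * expR (a * (mean - f t)))).
rewrite prodr_const.
have := mgf_deviation_le _ _ f M T_gt0 f_ge0 f_le a a0 aM3; rewrite -/mean.
move/(lerXn2r #|I|) => le_mgf.
apply: (@le_trans _ _ (E * expR (3 / 8 * (a * M) ^+ 2) ^+ #|I|)).
  rewrite ler_wpM2l ?expR_ge0 // le_mgf ?nnegrE ?expR_ge0 //.
  by apply: sumr_ge0 => t _; rewrite mulr_ge0 ?expR_ge0 ?invr_ge0.
(* Per index, [- a * eps + 3 / 8 * (a * M) ^+ 2] equals [- 2 * eps ^+ 2 / (3 * M ^+ 2)] for the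
   chosen [a]. *)
rewrite -expRM_natl -expRD ler_expR aM /a le_eqVlt; apply/orP; left; apply/eqP.
by field; rewrite gt_eqF.
Qed.
End UniformSample.

Theorem theorem1 (R : realType) (d : measure_display) (Omega : measurableType d)
    (P : probability Omega R) (n : nat) (S : 'I_n -> Omega -> state)
    (n_gt0 : (0 < n)%N)
    (S_random : forall i : 'I_n, random_element (S i))
    (S_uniform : forall i : 'I_n, uniformly_distributed P (S i))
    (S_indep : mutually_independent P S) :
  (P [set w | (rubik_diameter%:R >=
               2 * sample_mean R (fun i => S i w) + 36 / 100 :> R)%R]
   < (2 * expR (- n%:R / (1541 * 10 ^+ 3 + 939)))%:E)%E.
Proof.
pose f (s : state) : R := (rubik_dist s)%:R.
pose mean : R := (\sum_s f s) / #|{: state}|%:R.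
have card_gt0 : (0 < #|{: state}|)%N by apply/card_gt0P; exists 1%g.
have n0 : (0 : R) < n%:R by rewrite ltr0n.
have f_le s : f s <= 161 by rewrite /f ler_nat rubik_adj_dist_le.
have D_le : rubik_diameter%:R <= 2 * mean.
  rewrite /mean mulrA ler_pdivlMr ?ltr0n // mulrC -natr_sum -!natrM ler_nat.
  exact: rubik_diameter_mean.
(* The event says that the sum of the distances is at most [c], and [c <= n%:R * (mean - 18 / 100)]
   by [D_le]. *)
pose c : R := n%:R * ((rubik_diameter%:R - 36 / 100) / 2).
have -> : [set w | rubik_diameter%:R >=
    2 * sample_mean R (fun i => S i w) + 36 / 100] = [set w | \sum_i f (S i w) <= c].
  have meanE w : sample_mean R (fun i => S i w) = n%:R^-1 * \sum_i f (S i w).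
    exact: mulrC.
  by apply/seteqP; split=> w /=; rewrite meanE /c -ler_pdivrMl //; lra.
(* With [eps = 18 / 100] and [M = 161] the rate is about 1/1200046, better than the required
   1/1541939. *)
apply: (@le_lt_trans _ _ (expR (- (n%:R * (2 * (18 / 100) ^+ 2 / (3 * 161 ^+ 2)))))%:E).
  rewrite -[n in n%:R]card_ord; apply: uniform_lower_tail => //;
    rewrite ?card_ord; try lra.
  by rewrite /c ler_wpM2l ?ler0n // -/mean; lra.
rewrite lte_fin; set x := expR _; set y := expR _.
have xy : x <= y.
  rewrite ler_expR mulNr lerN2 ler_wpM2l ?ler0n // -[leLHS]mul1r ler_pdivrMr; last by lra.
  by rewrite mulrAC ler_pdivlMr; lra.
(* The factor 2 makes the inequality strict: [x <= y < 2 * y]. *)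
have : 0 < y by exact: expR_gt0.
lra.
Qed.
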